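(* Let $T_t$ be an aperiodic ergodic measure-preserving flow on a standard probability space $(X,m)$, and let $\varphi:(0,\infty)\to(0,\infty)$ satisfy $\varphi(t)\to0$ as $t\to+\infty$. Then there exists $f\in L_1(X,m)$ with $\int_X f\,dm=0$ such that for almost every $x\in X$ $$\limsup_{t\to+\infty}\frac{1}{\varphi(t)}|A(f,t,x)|=+\infty.$$
   Context: A flow is aperiodic if almost every point is not periodic (there is no $t>0$ with $T_tx=x$). Birkhoff average: $A(f,t,x)=\frac1t\int_0^t f(T_sx)\,ds$. *)

(* Defs.v *)
From HB Require Import structures.
From mathcomp Require Import all_boot all_order all_algebra.
From mathcomp Require Import all_classical all_reals all_analysis.
Set Implicit Arguments. Unset Strict Implicit. Unset Printing Implicit Defensive.
Import Order.TTheory GRing.Theory Num.Theory.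
Import numFieldNormedType.Exports.
Local Open Scope classical_set_scope.
Local Open Scope ring_scope.

(* Standard Borel space: Borel isomorphic to a Borel subset of the reals
   (Kuratowski): an injective measurable map into R sending measurable sets
   to Borel sets. *)
Definition standard_borel {d : measure_display} {R : realType}
  (X : measurableType d) : Prop :=
  exists e : X -> R, [/\ measurable_fun setT e, injective e &
     forall A : set X, measurable A -> measurable (e @` A)].

Definition measurable_flow {d : measure_display} {R : realType}
  (X : measurableType d) (T : R -> X -> X) : Prop :=
  [/\ measurable_fun setT (fun p : R * X => T p.1 p.2),
      (forall x, T 0 x = x) &
      (forall s t x, T (s + t) x = T s (T t x))].

Definition measure_preserving_flow {d : measure_display} {R : realType}
  (X : measurableType d) (m : probability X R) (T : R -> X -> X) : Prop :=
  measurable_flow T /\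
  forall t (A : set X), measurable A -> m (T t @^-1` A) = m A.

Definition ergodic_flow {d : measure_display} {R : realType}
  (X : measurableType d) (m : probability X R) (T : R -> X -> X) : Prop :=
  forall A : set X, measurable A -> (forall t, T t @^-1` A = A) ->
    m A = 0%E \/ m A = 1%E.

Definition aperiodic_flow {d : measure_display} {R : realType}
  (X : measurableType d) (m : probability X R) (T : R -> X -> X) : Prop :=
  {ae m, forall x, forall t : R, 0 < t -> T t x <> x}.

Definition birkhoff_avg {d : measure_display} {R : realType}
  (X : measurableType d) (T : R -> X -> X) (f : X -> R) (t : R) (x : X) : R :=
  t^-1 * Rintegral (@lebesgue_measure R) `[0, t] (fun s => f (T s x)).

(* Main.v *)
Require Import Defs.
From HB Require Import structures.
From mathcomp Require Import all_boot all_order all_algebra.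
From mathcomp Require Import all_classical all_reals all_analysis.
From mathcomp Require Import ring lra measurable_realfun.
Set Implicit Arguments. Unset Strict Implicit. Unset Printing Implicit Defensive.
Import Order.TTheory GRing.Theory Num.Theory.
Import numFieldNormedType.Exports.
Local Open Scope classical_set_scope.
Local Open Scope ring_scope.

(** A measurable set [C] of positive measure none of whose points returns to it
during the times [1 <= t <= L] exists by aperiodicity; for [L] large, the set of
points that meet [C] before a given time is small, while by ergodicity almost
every orbit meets [C]. Cutting the space according to the hitting time of [C],
in blocks of length [k * n], and letting [P] be the union of every other block,
the coboundary [1_P - 1_P \o T_(k * n)] has mean zero and bounded integrals along
orbits, and it is constantly [1] or [-1] on the orbit segment of length [n] of
most points. The function sought is [\sum_k 16^-k g_k] with [g_k] of this kind
for a time [n_k] chosen after [g_0, ..., g_(k-1)]: at time [n_k] the previous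
terms average to almost zero, the later ones are too small to matter, and
[phi n_k] is much smaller than [16^-k]. *)

(** * Integrals of bounded functions over intervals of the line *)

Section line_integral.
Context {R : realType}.
Implicit Types (h : R -> R) (a b c M : R).
Notation mu := (@lebesgue_measure R).

(** The image of Lebesgue measure under a translation gives each []x, y]] its length, and this
    characterises Lebesgue measure. *)
Lemma lebesgue_measure_shift c (A : set R) : measurable A ->
  mu ((fun s => s + c) @^-1` A) = mu A.
Proof.
move=> mA.
have mshift : measurable_fun [set: measurableTypeR R]
  ((fun s => s + c) : measurableTypeR R -> measurableTypeR R).
  by apply: measurable_funD => //; exact: measurable_cst.
have ms := isMeasurableFun.Build _ _ _ _ _ mshift.
pose s : {mfun measurableTypeR R >-> measurableTypeR R} :=
  HB.pack (fun s : R => s + c) ms.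
apply/esym/(@lebesgue_measure_unique R (pushforward mu s)) => //.
move=> _ [[x y] _ <-].
change (mu `]x, y]%classic = mu (s @^-1` `]x, y]%classic)).
have -> : s @^-1` `]x, y]%classic = `]x - c, y - c]%classic.
  by apply/seteqP; split => z /=; rewrite !in_itv/= ltrBlDr lerBrDr.
rewrite !lebesgue_measure_itv/= !lte_fin ltrD2r.
by case: ifP => // _; rewrite -!EFinB opprB addrA subrK.
Qed.

Lemma integrable_itv_bounded h M a b : measurable_fun setT h ->
  (forall s, `|h s| <= M) -> mu.-integrable `[a, b] (EFin \o h).
Proof.
move=> mh hM; apply: measurable_bounded_integrable => //.
- rewrite /= lebesgue_measure_itv/=; case: ifP => // _.
  by rewrite -EFinB ltry.
- exact: measurable_funTS.
- by exists M; split; rewrite ?num_real// => x Mx s _ /=; rewrite (le_trans (hM s))// ltW.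
Qed.

Lemma normr_Rintegral_itv_le h M a b : measurable_fun setT h ->
  (forall s, `|h s| <= M) -> a <= b ->
  `|\int[mu]_(s in `[a, b]) h s| <= M * (b - a).
Proof.
move=> mh hM ab; have ih := integrable_itv_bounded a b mh hM.
apply: le_trans (le_normr_Rintegral _ _) _ => //.
have -> : M * (b - a) = \int[mu]_(s in `[a, b]) M.
  rewrite Rintegral_cst//= lebesgue_measure_itv/= lte_fin.
  by case: ltgtP ab => // -> _; rewrite subrr.
apply: le_Rintegral => //; first exact: integrable_norm.
by apply: (@integrable_itv_bounded _ `|M|).
Qed.

Lemma Rintegral_itv_split h M a b c : measurable_fun setT h ->
  (forall s, `|h s| <= M) -> a <= b -> b <= c ->
  \int[mu]_(s in `[a, c]) h s =
  \int[mu]_(s in `[a, b]) h s + \int[mu]_(s in `[b, c]) h s.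
Proof.
move=> mh hM ab bc; have ih := integrable_itv_bounded a c mh hM.
rewrite -[X in _ + X]Rintegral_itv_obnd_cbnd; last first.
  apply: integrableS (integrable_itv_bounded b c mh hM) => //.
  exact: subset_itv_oc_cc.
by rewrite -(@Rintegral_itvB _ _ (BLeft a) _ b ih)// addrC subrK.
Qed.

Lemma Rintegral_shift h M a b c : measurable_fun setT h ->
  (forall s, `|h s| <= M) ->
  \int[mu]_(s in `[a, b]) h (s + c) = \int[mu]_(s in `[a + c, b + c]) h s.
Proof.
move=> mh hM.
have mshift : measurable_fun [set: measurableTypeR R]
  ((fun s => s + c) : measurableTypeR R -> measurableTypeR R).
  by apply: measurable_funD => //; exact: measurable_cst.
have ms := isMeasurableFun.Build _ _ _ _ _ mshift.
pose s : {mfun measurableTypeR R >-> measurableTypeR R} :=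
  HB.pack (fun s : R => s + c) ms.
have sE : s @^-1` `[a + c, b + c]%classic = `[a, b]%classic.
  by apply/seteqP; split => z /=; rewrite !in_itv/= !lerD2r.
congr fine; rewrite -[in LHS]sE.
transitivity (\int[pushforward mu s]_(x in `[(a + c)%R, (b + c)%R]) (h x)%:E)%E.
  rewrite (integral_pushforward mshift)//=.
  - exact/measurable_EFinP.
  - rewrite -/(s @^-1` _) sE.
    apply: (@integrable_itv_bounded (fun x => h (x + c)) M) => //.
    exact: (measurableT_comp mh mshift).
apply: eq_measure_integral => A mA _.
exact: lebesgue_measure_shift.
Qed.

(** By Lebesgue differentiation [h] is almost everywhere on []0, 1[] the derivative of its
    primitive, which is locally zero there. Without a zero of [h], the whole of []0, 1[] would lie
    in a null set. *)
Lemma vanishing_primitive_zero h M : measurable_fun setT h ->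
  (forall s, `|h s| <= M) ->
  (forall q : R, 0 <= q <= 1 -> \int[mu]_(s in `[0, q]) h s = 0) ->
  exists s, h s = 0.
Proof.
move=> mh hM h0; apply: contrapT => /forallNP hn0.
have /FTC1 : forall y, mu.-integrable [set` Interval (BLeft 0) (BRight y)]
    (EFin \o h) by move=> y; exact: integrable_itv_bounded hM.
have loch : locally_integrable setT h.
  split => //; first exact: openT.
  move=> K _ cK; have [L [_ KL]] := compact_bounded cK.
  have mK := compact_measurable cK.
  have /integrableP[_] : mu.-integrable `[- (`|L| + 1), `|L| + 1] (EFin \o h).
    exact: integrable_itv_bounded hM.
  apply: le_lt_trans; apply: ge0_subset_integral => //=.
    by apply/measurable_EFinP/measurableT_comp => //; exact: measurable_funTS.
  move=> z Kz /=; rewrite in_itv/= -ler_norml; apply: (KL (`|L| + 1)) => //.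
  by rewrite ltr_pwDr// ler_norm.
move/(_ loch) => /= [N [mN muN0 HN]].
suff : (mu `]0%R, 1%R[%classic <= mu N)%E.
  by rewrite muN0 lebesgue_measure_itv/= lte01 oppr0 adde0 leNgt lte_fin ltr01.
apply: le_measure; rewrite ?inE//= => z; rewrite /= in_itv/= => /andP[z0 z1].
apply: HN => /= /(_ _)[|_]; first by rewrite lte_fin.
set F := fun x => _; suff -> : derive1 F z = 0 by move=> /esym/hn0.
rewrite derive1E.
have zz : {near z, F =1 cst 0}.
  near=> y; apply: h0; apply/andP; split.
    by apply: ltW; near: y; exact: lt_nbhsr.
  by apply: ltW; near: y; exact: lt_nbhsl.
rewrite (near_eq_derive _ zz).
exact: derive_cst.
Unshelve. all: by end_near. Qed.

End line_integral.

Lemma probability_integrable_bounded (d : measure_display) (R : realType)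
    (X : measurableType d) (m : probability X R) (f : X -> R) (M : R) :
  measurable_fun setT f -> (forall x, `|f x| <= M) ->
  m.-integrable setT (EFin \o f).
Proof.
move=> mf fM; apply: measurable_bounded_integrable => //.
  by rewrite ltey_eq fin_num_measure.
exists M; split; rewrite ?num_real// => y My x _ /=.
by rewrite (le_trans (fM x))// ltW.
Qed.

Lemma measure_gt0_bigcup (d : measure_display) (R : realType)
    (X : measurableType d) (m : {measure set X -> \bar R})
    (A : set X) (B : nat -> set X) :
  measurable A -> (forall n, measurable (B n)) -> A `<=` \bigcup_n B n ->
  (0 < m A)%E -> exists n, (0 < m (A `&` B n))%E.
Proof.
move=> mA mB AB A0; apply: contrapT => /forallNP H.
have : m.-negligible (\bigcup_n (A `&` B n)).
  apply: negligible_bigcup => n; apply/negligibleP; first exact: measurableI.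
  by apply/eqP; rewrite -measure_le0 leNgt; apply/negP/H.
rewrite -setI_bigcupr setIidl// => /negligibleP -/(_ mA) mA0.
by rewrite mA0 ltxx in A0.
Qed.

(** * Measurability and integrals along the orbits of a flow *)

Section flow.
Context {d : measure_display} {R : realType} {X : measurableType d}.
Context (T : R -> X -> X) (flowT : measurable_flow T).
Notation mu := (@lebesgue_measure R).

Let mT : measurable_fun setT (fun p : R * X => T p.1 p.2).
Proof. by case: flowT. Qed.

Lemma flow0 x : T 0 x = x. Proof. by case: flowT. Qed.

Lemma flowD s t x : T (s + t) x = T s (T t x). Proof. by case: flowT. Qed.

Lemma flowK s x : T (- s) (T s x) = x.
Proof. by rewrite -flowD addNr flow0. Qed.

Lemma measurable_flow_time t : measurable_fun setT (T t).
Proof.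
apply: (measurableT_comp (f := fun p : R * X => T p.1 p.2) (g := pair t)) => //.
Qed.

Lemma measurable_orbit x : measurable_fun setT (T ^~ x).
Proof.
apply: (measurableT_comp (f := fun p : R * X => T p.1 p.2)
  (g := fun s => (s, x))) => //.
Qed.

Lemma measurable_orbit_comp (h : X -> R) x : measurable_fun setT h ->
  measurable_fun setT (fun s => h (T s x)).
Proof. by move=> mh; exact: (measurableT_comp mh (measurable_orbit x)). Qed.

Lemma measurable_flow_preimage t (A : set X) : measurable A ->
  measurable (T t @^-1` A).
Proof. by move=> mA; rewrite -[_ @^-1` _]setTI; exact: measurable_flow_time. Qed.

(** Shifting the start by [t] turns the window [[0, q]] into [[t, q + t]]. Splitting the integral
    over [[0, q + t]] at [t] and at [q] leaves two pieces of length [t], whether or not [t] exceeds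
    [q]. *)
Lemma normr_orbit_integral_flowB (h : X -> R) M q t x :
  measurable_fun setT h -> (forall y, `|h y| <= M) -> 0 <= q -> 0 <= t ->
  `|\int[mu]_(s in `[0, q]) h (T s (T t x)) -
    \int[mu]_(s in `[0, q]) h (T s x)| <= 2 * M * t.
Proof.
move=> mh hM q0 t0; have qt : t <= q + t by rewrite lerDr.
have tq : q <= q + t by rewrite lerDl.
have mhx := measurable_orbit_comp x mh.
have hxM s : `|h (T s x)| <= M by [].
have -> : \int[mu]_(s in `[0, q]) h (T s (T t x)) =
    \int[mu]_(s in `[t, q + t]) h (T s x).
  have := Rintegral_shift 0 q t mhx hxM; rewrite add0r => <-.
  by apply: eq_Rintegral => s _; rewrite flowD.
have E1 := Rintegral_itv_split mhx hxM t0 qt.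
have E2 := Rintegral_itv_split mhx hxM q0 tq.
have := normr_Rintegral_itv_le mhx hxM t0.
have := normr_Rintegral_itv_le mhx hxM tq.
rewrite !ler_norml => /andP[? ?] /andP[? ?]; apply/andP; split; lra.
Qed.

(** The restriction of time to [D] becomes a factor, so that Tonelli applies on the whole product of
    the line with [X]. *)
Let kern (h : X -> R) (D : set R) (p : R * X) : \bar R :=
  ((h (T p.1 p.2)) * \1_D p.1)%:E.

Let measurable_kern h D : measurable_fun setT h -> measurable D ->
  measurable_fun setT (kern h D).
Proof.
move=> mh mD; apply/measurable_EFinP; apply: measurable_funM.
  exact: (measurableT_comp mh mT).
apply: (measurableT_comp (f := \1_D : R -> R) (g := fst)) => //.
Qed.

Let kernE h (t : R) x : (\int[mu]_(s in `[0%R, t]) (h (T s x))%:E =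
  \int[mu]_s kern h `[0%R, t] (s, x))%E.
Proof.
rewrite integral_mkcond/=; apply: eq_integral => s _.
rewrite /kern patchE indicE; case: ifPn => _ /=; by rewrite ?mulr1 ?mulr0.
Qed.

Lemma measurable_orbit_integral (h : X -> R) t : measurable_fun setT h ->
  (forall x, 0 <= h x) ->
  measurable_fun setT (fun x => \int[mu]_(s in `[0%R, t]) (h (T s x))%:E)%E.
Proof.
move=> mh h0; under eq_fun do rewrite kernE.
apply: (@measurable_fun_fubini_tonelli_G _ _ _ _ _ mu (kern h `[0, t])).
- exact: measurable_kern.
- by move=> p; rewrite lee_fin mulr_ge0.
Qed.

(** Tonelli lets the integral over [X] come first; for each time [s] invariance makes it [m C]. *)
Lemma integral_orbit_integral (m : probability X R) (C : set X) t :
  (forall s (A : set X), measurable A -> m (T s @^-1` A) = m A) ->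
  measurable C -> 0 <= t ->
  (\int[m]_x \int[mu]_(s in `[0%R, t]) (\1_C (T s x))%:E = t%:E * m C)%E.
Proof.
move=> mpT mC t0; under eq_integral do rewrite kernE.
have mI : measurable_fun setT (\1_C : X -> R) by exact: measurable_indic.
have k0 p : (0 <= kern \1_C `[0%R, t] p)%E by rewrite lee_fin mulr_ge0.
rewrite -(@fubini_tonelli _ _ _ _ _ mu m (kern \1_C `[0%R, t])) => //;
  last exact: measurable_kern.
transitivity (\int[mu]_(s in `[0%R, t]) m C)%E.
  rewrite [RHS]integral_mkcond/=; apply: eq_integral => s _.
  rewrite patchE /kern/= indicE; case: ifPn => _ /=.
    under eq_integral do rewrite mulr1.
    rewrite -(mpT s)// -[X in _ = m X]setIT -integral_indic//.
    exact: measurable_flow_preimage.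
  by under eq_integral do rewrite mulr0; rewrite integral0.
rewrite integral_cst//= muleC lebesgue_measure_itv/= lte_fin.
by case: ltgtP t0 => // [_ _|<- _]; rewrite ?oppr0 ?adde0 // .
Qed.

End flow.

(** * A set of positive measure without returns during the times [[1, L]] *)

Section local_section.
Context {d : measure_display} {R : realType} {X : measurableType d}.
Context (m : probability X R) (T : R -> X -> X) (flowT : measurable_flow T).
Context (e : X -> R) (me : measurable_fun setT e) (e_inj : injective e).
Context (e01 : forall x, 0 <= e x <= 1).
Notation mu := (@lebesgue_measure R).

(* Unlike [e] itself, its primitives are Lipschitz along orbits, so that the
   condition defining [sep] may be tested on a finite grid of times; they still
   separate points because [e] is injective. *)
Let F (q : R) (x : X) : R := \int[mu]_(s in `[0, q]) e (T s x).

Let e_bounded x : `|e x| <= 1.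
Proof. by have /andP[e0 e1] := e01 x; rewrite ger0_norm. Qed.

Let mex x : measurable_fun setT (fun s => e (T s x)).
Proof. exact: (measurable_orbit_comp flowT x me). Qed.

Let measurable_F q : measurable_fun setT (F q).
Proof.
apply: (measurableT_comp (f := @fine R)) => //.
by apply: (measurable_orbit_integral flowT) => // x; have /andP[] := e01 x.
Qed.

Let F_ge0 q x : 0 <= F q x.
Proof. by apply: Rintegral_ge0 => s _; have /andP[] := e01 (T s x). Qed.

Let F_lip (q q' : R) x : 0 <= q -> q <= q' -> `|F q' x - F q x| <= q' - q.
Proof.
move=> q0 qq'; rewrite /F (@Rintegral_itv_split _ _ 1 0 q q')// addrC addKr.
by rewrite -[leRHS]mul1r; exact: normr_Rintegral_itv_le.
Qed.

Let F_flow_lip (q s t : R) x : 0 <= q ->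
  `|F q (T s x) - F q (T t x)| <= 2 * `|s - t|.
Proof.
move=> q0; wlog st : s t / t <= s.
  by move=> H; have [/H//|/ltW/H] := leP t s; rewrite distrC (distrC t).
rewrite -[s in T s](subrK t) (flowD flowT) (ger0_norm (x := s - t)) ?subr_ge0//.
rewrite -[2]mulr1; apply: (normr_orbit_integral_flowB flowT) => //.
by rewrite subr_ge0.
Qed.

(** Equal primitives force [e] to agree on both orbits at some common time; the two orbits then meet
    at that time, and flowing back gives [x = y]. *)
Let F_inj x y : (forall q : R, 0 <= q <= 1 -> F q x = F q y) -> x = y.
Proof.
move=> Fxy.
have [s /subr0_eq/e_inj Tsxy] : exists s, e (T s x) - e (T s y) = 0.
  apply: (@vanishing_primitive_zero _ _ 2).
  - exact: measurable_funB.
  - move=> s; rewrite (le_trans (ler_normB _ _))//.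
    have := e_bounded (T s x); have := e_bounded (T s y); lra.
  - move=> q q01; rewrite RintegralB//; last 2 first.
      exact: integrable_itv_bounded.
      exact: integrable_itv_bounded.
    by apply/eqP; rewrite subr_eq0; apply/eqP; exact: Fxy.
by rewrite -(flowK flowT s x) Tsxy (flowK flowT).
Qed.

Let node (N i : nat) : R := i%:R / N.+1%:R.

Let node_floor N (q : R) : 0 <= q ->
  exists i, [/\ node N i <= q, q - node N i <= N.+1%:R^-1,
   forall j, j%:R <= q -> (j * N.+1 <= i)%N &
   forall j, q <= j%:R -> (i <= j * N.+1)%N].
Proof.
move=> q0; exists (Num.truncn (q * N.+1%:R)).
have qN0 : 0 <= q * N.+1%:R by rewrite mulr_ge0.
have /andP[qN1 qN2] := truncn_itv qN0; split.
- by rewrite ler_pdivrMr.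
- rewrite lerBlDr -[X in X + _]mul1r -mulrDl ler_pdivlMr//.
  by rewrite addrC natr1 ltW.
- by move=> j qj; rewrite truncn_ge_nat// natrM ler_wpM2r.
- move=> j qj; rewrite -(ler_nat R) (le_trans qN1)// natrM.
  by rewrite ler_wpM2r.
Qed.

(** One grid of mesh [1 / N.+1] serves for flow times in [[1, L]] (index [j]) and for integration
    lengths in [[0, 1]] (index [i]). The constant 10 leaves room for the error of 3 meshes made in
    [exists_local_section]. *)
Let sep (L N : nat) : set X :=
  \bigcap_(j in [set j | (N.+1 <= j <= L * N.+1)%N])
  \bigcup_(i in [set i | (i <= N.+1)%N])
  [set x | 10 / N.+1%:R <= `|F (node N i) x - F (node N i) (T (node N j) x)|].

Let measurable_sep L N : measurable (sep L N).
Proof.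
apply: bigcap_measurableType => j _; apply: bigcup_measurable => i _.
have mf : measurable_fun setT
    (fun x => `|F (node N i) x - F (node N i) (T (node N j) x)|).
  apply: measurableT_comp => //; apply: measurable_funB => //.
  exact: measurableT_comp (measurable_F _) (measurable_flow_time flowT _).
have := mf measurableT `[10 / N.+1%:R, +oo[%classic (measurable_itv _).
by rewrite setTI; congr measurable; apply/seteqP; split => x /=;
  rewrite in_itv/= andbT.
Qed.

Let node_ge0 N i : 0 <= node N i.
Proof. by rewrite divr_ge0. Qed.

(** A point outside every [sep L N] has times [t N] in [[1, L]] at which its primitives come back up
    to [12 / N.+1]. At a cluster point [u] of these times they come back exactly, so [T u x = x]
    with [u >= 1]. *)
Let sep_cover L x : (forall t : R, 0 < t -> T t x <> x) ->
  (\bigcup_N sep L N) x.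
Proof.
move=> aper; apply: contrapT => ncov.
have nsep N : ~ sep L N x by move=> sepx; apply: ncov; exists N.
(* The 12 is the 10 of [sep] plus one mesh for each of the two points when [q] is rounded down to a
   node. *)
have H N : exists t, [/\ 1 <= t, t <= L%:R &
    forall q : R, 0 <= q <= 1 -> `|F q x - F q (T t x)| <= 12 / N.+1%:R].
  have [j jN jF] : exists2 j, (N.+1 <= j <= L * N.+1)%N & forall i,
      (i <= N.+1)%N -> `|F (node N i) x - F (node N i) (T (node N j) x)| <
       10 / N.+1%:R.
    apply: contrapT => Hn; apply: (nsep N) => j jN.
    apply: contrapT => Hi; apply: Hn; exists j => // i iN.
    by rewrite ltNge; apply/negP => Fi; apply: Hi; exists i.
  exists (node N j); case/andP: jN => Nj jL; split.
  - by rewrite ler_pdivlMr// mul1r ler_nat.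
  - by rewrite ler_pdivrMr// -natrM ler_nat.
  - move=> q /andP[q0 q1]; have [i [iq qi _ iN]] := node_floor N q0.
    have {}iN : (i <= N.+1)%N by rewrite -(mul1n N.+1); exact: iN.
    have := jF _ iN.
    have := F_lip x (node_ge0 N i) iq.
    have := F_lip (T (node N j) x) (node_ge0 N i) iq.
    rewrite !ler_norml !ltr_norml.
    move: qi; set c := N.+1%:R^-1 => ? /andP[? ?] /andP[? ?] /andP[? ?].
    by apply/andP; split; lra.
have {H} [t Ht] := choice H.
have : compact `[1%R, L%:R : R]%classic by exact: segment_compact.
move=> /(_ (t @ \oo) _)[].
  by exists 0%N => // n _ /=; rewrite in_itv/=; have [-> ->] := Ht n.
move=> u [/=]; rewrite in_itv/= => /andP[u1 _] clu.
apply: (aper u); first exact: lt_le_trans u1.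
apply/esym/F_inj => q q01.
apply/eqP; rewrite -subr_eq0 -normr_le0; apply/ler_addgt0Pr => eps eps0.
rewrite add0r.
(* Beyond [N0] the error [12 / N.+1] is at most [eps / 2]; the other half pays for replacing [t N]
   by [u], at distance below [eps / 4] with Lipschitz constant 2. *)
pose N0 := Num.truncn (24 / eps).
have [_ [[N NN0 <-] tNu]] := clu (t @` [set n | (N0 <= n)%N]) (ball u (eps / 4))
  (ex_intro2 _ _ N0 I (fun n nN => ex_intro2 _ _ n nN erefl))
  (nbhsx_ballx _ _ (divr_gt0 eps0 (ltr0n _ 4))).
have [_ _ /(_ q q01)] := Ht N.
have /andP[q0 _] := q01.
have := F_flow_lip (t N) u x q0.
move: tNu; rewrite /ball/= distrC => tNu.
have : 12 / N.+1%:R <= eps / 2.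
  have : 24 / eps <= N.+1%:R.
    have /andP[_ /ltW] := truncn_itv (divr_ge0 (ler0n R 24) (ltW eps0)).
    by move=> /le_trans; apply; rewrite ler_nat ltnS.
  by rewrite !ler_pdivrMr// => h; lra.
move=> h1 h2 h3.
rewrite -(subrKA (F q (T (t N) x))) (le_trans (ler_normD _ _))//.
move: tNu h1 h2 h3; set c := 12 / _ => *; lra.
Qed.

(** The values of each primitive are cut into countably many slabs of height [1 / N.+1], one of
    which keeps positive measure; this is repeated for [n] primitives. *)
Let positive_piece N (A : set X) n : measurable A -> (0 < m A)%E ->
  exists B, [/\ measurable B, B `<=` A, (0 < m B)%E &
    forall i x y, (i < n)%N -> B x -> B y ->
      `|F (node N i) x - F (node N i) y| <= N.+1%:R^-1].
Proof.
move=> mA A0; elim: n => [|n [B [mB BA B0 HB]]]; first by exists A; split.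
pose P k := [set x | node N k <= F (node N n) x < node N k.+1].
have mP k : measurable (P k).
  have mf := measurable_F (node N n).
  have := mf measurableT `[node N k, node N k.+1[%classic (measurable_itv _).
  by rewrite setTI.
have [|k Bk] := measure_gt0_bigcup mB mP _ B0.
  move=> x Bx; exists (Num.truncn (F (node N n) x * N.+1%:R)) => //=.
  have /andP[h1 h2] := truncn_itv (mulr_ge0 (F_ge0 (node N n) x) (ler0n R N.+1)).
  by rewrite /P/= /node ler_pdivrMr// ltr_pdivlMr// h1.
exists (B `&` P k); split => //.
- exact: measurableI.
- by move=> x [/BA].
- move=> i x y; rewrite ltnS leq_eqVlt => /predU1P[->|ni] [Bx Px] [By Py].
    have nodeS : node N k.+1 = node N k + N.+1%:R^-1.
      by rewrite /node -(natr1 k) mulrDl mul1r.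
    move: Px Py; rewrite /P/= nodeS; set c := _^-1.
    move=> /andP[? ?] /andP[? ?].
    by rewrite ler_norml; apply/andP; split; lra.
  exact: HB.
Qed.

(** Some [sep L N] has positive measure, and so has a piece [C] of it on which the primitives at the
    nodes vary by at most one mesh. A return to [C] at time [t] would then make them vary by at most
    3 meshes between [x] and its image at the node below [t], against the 10 of [sep]. *)
Lemma exists_local_section (L : nat) : aperiodic_flow m T ->
  exists C, [/\ measurable C, (0 < m C)%E &
    forall x t, C x -> 1 <= t <= L%:R -> ~ C (T t x)].
Proof.
move=> aper.
have mcov : measurable (\bigcup_N sep L N) by exact: bigcup_measurable.
have cov1 : m (\bigcup_N sep L N) = 1%E.
  case: aper => Z [mZ Z0 HZ].
  apply/eqP; rewrite eq_le probability_le1//=.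
  rewrite -(@probability_setT _ _ _ m) -[leRHS]addr0 -Z0.
  apply: le_trans (measureU2 _ mcov mZ).
  apply: le_measure; rewrite ?inE//; first exact: measurableU.
  move=> x _; have [ax|ax] := pselect (forall t : R, 0 < t -> T t x <> x).
    by left; exact: sep_cover.
  by right; apply: HZ.
have [N N0] : exists N, (0 < m (\bigcup_N sep L N `&` sep L N))%E.
  have cov0 : (0 < m (\bigcup_N sep L N))%E by rewrite cov1 lte01.
  exact: (measure_gt0_bigcup mcov (measurable_sep L) _ cov0).
(* [N.+2] counts the nodes of [[0, 1]], both endpoints included. *)
have [|C [mC CN C0 HC]] := @positive_piece N _ N.+2 _ N0.
  exact: measurableI.
exists C; split => // x t Cx /andP[t1 tL] CTx.
have t0 : 0 <= t by rewrite (le_trans ler01).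
have [j [jt tj Nj jN]] := node_floor N t0.
have [_ /(_ j)[]] := CN _ Cx.
  by rewrite /= jN// andbT -(mul1n N.+1) Nj.
move=> i /= iN; rewrite leNgt => /negP; apply.
have := HC i _ _ iN Cx CTx.
have := F_flow_lip t (node N j) x (node_ge0 N i).
have : 0 < N.+1%:R^-1 :> R by rewrite invr_gt0.
rewrite (ger0_norm (x := t - _)) ?subr_ge0//.
move: tj; rewrite !ler_norml ltr_norml; set c := N.+1%:R^-1.
by move=> ? ? /andP[? ?] /andP[? ?]; apply/andP; split; lra.
Qed.

End local_section.

(** The measures of [n.+1] disjoint sets sum to at most 1, so they cannot all exceed [1 / n.+1]. *)
Lemma disjoint_family_small (d : measure_display) (R : realType)
    (X : measurableType d) (m : probability X R) (A : nat -> set X) n :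
  (forall i, measurable (A i)) ->
  (forall i j x, (i < j <= n)%N -> A i x -> ~ A j x) ->
  exists2 i, (i <= n)%N & (m (A i) <= n.+1%:R^-1%:E)%E.
Proof.
move=> mA dA; apply: contrapT => H.
have {}H i : (i <= n)%N -> n.+1%:R^-1 < fine (m (A i)).
  move=> ni; rewrite ltNge; apply/negP => Ai; apply: H; exists i => //.
  by rewrite -[leLHS]fineK ?fin_num_measure// lee_fin.
have tA : trivIset `I_n.+1 A.
  apply/trivIsetP => i j /= ni nj ij.
  rewrite -subset0 => x [Aix Ajx].
  by case: (ltngtP i j) ij => // ij _;
    [apply: (dA i j x) | apply: (dA j i x)] => //; rewrite ij.
have : (\sum_(i < n.+1) m (A i) <= 1)%E.
  rewrite -measure_semi_additive_ord_I//; last exact: bigsetU_measurable.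
  by apply: probability_le1; exact: bigsetU_measurable.
apply/negP; rewrite -ltNge.
rewrite (eq_bigr (fun i : 'I_n.+1 => (fine (m (A i)))%:E)); last first.
  by move=> i _; rewrite fineK// fin_num_measure.
rewrite sumEFin lte_fin.
have -> : 1 = \sum_(i < n.+1) n.+1%:R^-1 :> R.
  by rewrite sumr_const card_ord -[RHS]mulr_natr mulVf.
apply: ltr_sum => [|i _]; last by apply: H; rewrite -ltnS.
by apply/hasP; exists ord0 => //; rewrite mem_index_enum.
Qed.

(** * Hitting times of the section *)

Section hit.
Context {d : measure_display} {R : realType} {X : measurableType d}.
Context (T : R -> X -> X) (flowT : measurable_flow T).
Context (C : set X) (mC : measurable C).
Notation mu := (@lebesgue_measure R).

(* Only visits of positive duration count: the set of points that visit [C] at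
   all need not be measurable. *)
Definition hit (t : R) : set X :=
  [set x | (0 < mu (`[0%R, t] `&` [set s | C (T s x)]))%E].

Let measurable_visits x : measurable [set s | C (T s x)].
Proof.
have := measurable_orbit flowT x measurableT mC.
by rewrite setTI.
Qed.

Let measurable_visits_itv a b x :
  measurable (`[a, b]%classic `&` [set s | C (T s x)]).
Proof. by apply: measurableI; [exact: measurable_itv|]. Qed.

Let visitE t x : mu (`[0%R, t] `&` [set s | C (T s x)]) =
  (\int[mu]_(s in `[0%R, t]) (\1_C (T s x))%:E)%E.
Proof.
rewrite setIC -integral_indic//; exact: measurable_visits.
Qed.

Lemma measurable_hit t : measurable (hit t).
Proof.
have mI : measurable_fun setT (\1_C : X -> R) by exact: measurable_indic.
have mv := measurable_orbit_integral flowT t mI (fun x => ler0n R _).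
have := emeasurable_fun_o_infty measurableT mv 0%E.
rewrite setTI; congr measurable; apply/seteqP; split => x /=;
  by rewrite /hit/= visitE.
Qed.

Lemma hit_sub s t : s <= t -> hit s `<=` hit t.
Proof.
move=> st x /lt_le_trans; apply; apply: le_measure.
- by rewrite inE; exact: measurable_visits_itv.
- by rewrite inE; exact: measurable_visits_itv.
- move=> u [/=]; rewrite !in_itv/= => /andP[-> us] Cu; split => //.
  exact: le_trans st.
Qed.

Lemma hit0 x : ~ hit 0 x.
Proof.
rewrite /hit/=; apply/negP; rewrite -leNgt.
rewrite -(lebesgue_measure_set1 (0 : R)); apply: le_measure; rewrite ?inE//.
- exact: measurable_visits_itv.
- by move=> s [/=]; rewrite in_itv/= => /le_anti.
Qed.

Lemma hit_visit t x : hit t x -> exists2 s, 0 <= s <= t & C (T s x).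
Proof.
move=> hx; apply: contrapT => H; move: hx.
rewrite /hit/= (_ : _ `&` _ = set0) ?measure0 ?ltxx//.
by apply/seteqP; split => // s [/=]; rewrite in_itv/= => ts Cs; apply: H; exists s.
Qed.

Let visit_flow t a x : mu (`[0%R, t] `&` [set s | C (T s (T a x))]) =
  mu (`[a, t + a] `&` [set s | C (T s x)]).
Proof.
rewrite -[RHS](@lebesgue_measure_shift _ a); last exact: measurable_visits_itv.
congr (mu _); apply/seteqP; split => s /=; rewrite !in_itv/= (flowD flowT);
  by rewrite lerD2r lerDr.
Qed.

Lemma hit_flow t a x : 0 <= a -> hit t (T a x) -> hit (t + a) x.
Proof.
move=> a0; rewrite /hit/= visit_flow => /lt_le_trans; apply; apply: le_measure.
- by rewrite inE; exact: measurable_visits_itv.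
- by rewrite inE; exact: measurable_visits_itv.
- move=> u [/=]; rewrite !in_itv/= => /andP[au ->] Cu; split => //.
  by rewrite (le_trans a0).
Qed.

(** The visits during [[0, a]] have measure zero, so all the visiting time up to [t + a] falls in
    [[a, t + a]]. *)
Lemma hit_flow_inv t a x : 0 <= a -> 0 <= t ->
  ~ hit a x -> hit (t + a) x -> hit t (T a x).
Proof.
move=> a0 t0 /negP; rewrite /hit/= -leNgt measure_le0 => /eqP na.
rewrite visit_flow => /lt_le_trans; apply.
rewrite -[leRHS]add0e -na; apply: le_trans (measureU2 _ _ _).
- apply: le_measure; rewrite ?inE.
  + exact: measurable_visits_itv.
  + by apply: measurableU; exact: measurable_visits_itv.
  + move=> u [/=]; rewrite !in_itv/= => /andP[u0 uta] Cu.
    by have [au|/ltW ua] := leP a u; [right|left]; split => //;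
      apply/andP.
- exact: measurable_visits_itv.
- exact: measurable_visits_itv.
Qed.

Context (m : probability X R).
Context (mpT : forall t (A : set X), measurable A -> m (T t @^-1` A) = m A).

(** [m C] is the mean time spent in [C] during [[0, 1]]; this time is at most 1, and zero outside
    [hit 1]. *)
Lemma le_measure_hit1 : (m C <= m (hit 1))%E.
Proof.
rewrite -[leLHS]mul1e -(integral_orbit_integral flowT mpT mC ler01).
have <- : (\int[m]_x (\1_(hit 1) x)%:E = m (hit 1))%E.
  by rewrite integral_indic// ?setIT//; exact: measurable_hit.
apply: ge0_le_integral => //.
- by move=> x _; apply: integral_ge0 => s _; rewrite lee_fin.
- apply: measurable_orbit_integral => //; exact: measurable_indic.
- apply/measurable_EFinP/measurable_indic; exact: measurable_hit.
move=> x _; rewrite -visitE indicE; case: (boolP (x \in hit 1)).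
  move=> _; apply: (@le_trans _ _ (mu `[0%R, 1%R]%classic)).
    by apply: le_measure; rewrite ?inE//; exact: measurable_visits_itv.
  by rewrite lebesgue_measure_itv/= lte_fin ltr01 oppr0 adde0.
by rewrite notin_setE /hit/= => /negP; rewrite -leNgt.
Qed.

(** The preimages of [hit H%:R] at the times [i * H.+1], for [i <= K], have equal measure. They are
    disjoint: a common point of two of them would visit [C] twice, and the spacing [H.+1] puts the
    delay between 1 and [K * H.+1 + H]. *)
Lemma hit_small (H K : nat) :
  (forall x t, C x -> 1 <= t <= (K * H.+1 + H)%:R -> ~ C (T t x)) ->
  (m (hit H%:R) <= K.+1%:R^-1%:E)%E.
Proof.
move=> HC.
have [] := @disjoint_family_small _ _ _ m
    (fun i => T (i * H.+1)%:R @^-1` hit H%:R) K.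
- by move=> i; apply: (measurable_flow_preimage flowT); exact: measurable_hit.
- move=> i j x /andP[ij jK] /hit_visit[s /andP[s0 sH] Cs].
  move=> /hit_visit[s' /andP[s'0 s'H] Cs'].
  apply: (HC _ (s' + ((j - i) * H.+1)%:R - s) Cs).
    have h1 : (H.+1%:R : R) <= ((j - i) * H.+1)%:R.
      by rewrite ler_nat leq_pmull// subn_gt0.
    have h2 : ((j - i) * H.+1)%:R <= (K * H.+1)%:R :> R.
      by rewrite ler_nat leq_mul2r (leq_trans (leq_subr _ _) jK) orbT.
    move: h1 h2; rewrite natrD -(natr1 H).
    by set a := ((j - i) * _)%:R; set b := (K * _)%:R => *; apply/andP; split; lra.
  rewrite -!(flowD flowT) subrK -addrA -natrD -mulnDl subnK 1?ltnW//.
  by rewrite (flowD flowT).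
by move=> i _; rewrite mpT//; exact: measurable_hit.
Qed.

(** The set [N] of points that never hit is only forward invariant, so ergodicity is applied to an
    invariant subset [Q] of the same measure. Full measure of [Q] would make [hit 1] null, against
    [le_measure_hit1]. *)
Lemma ae_hit : ergodic_flow m T -> (0 < m C)%E ->
  m (~` \bigcup_(n : nat) hit n%:R) = 0%E.
Proof.
move=> erg C0; set N := ~` _.
have mN : measurable N.
  by apply: measurableC; apply: bigcup_measurable => n _; exact: measurable_hit.
have mTN t : measurable (T t @^-1` N) by exact: measurable_flow_preimage.
have fwd t x : 0 <= t -> N x -> N (T t x).
  move=> t0 Nx [n _ hn]; apply: Nx.
  exists (n + (Num.truncn t).+1)%N => //; rewrite natrD.
  have /andP[_ /ltW tt] := truncn_itv t0.
  by apply: hit_sub (hit_flow t0 hn); rewrite lerD2l.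
pose Q := \bigcap_(n : nat) T (- n%:R) @^-1` N.
have mQ : measurable Q by exact: bigcap_measurableType.
have NQ : m (N `\` Q) = 0%E.
  apply/negligibleP; first exact: measurableD.
  apply: (@negligibleS _ _ _ _ (\bigcup_n (N `\` T (- n%:R) @^-1` N))).
    move=> x [Nx Qx]; apply: contrapT => H; apply: Qx => n _ /=.
    by apply: contrapT => nN; apply: H; exists n.
  apply: negligible_bigcup => n.
  apply/negligibleP; first exact: measurableD.
  (* By forward invariance this preimage lies inside [N]; having the same measure as [N], it differs
     from it by a null set. *)
  have NE : N `&` T (- n%:R) @^-1` N = T (- n%:R) @^-1` N.
    apply/seteqP; split => [x []//|x TNx]; split => //.
    move: TNx => /= /(@fwd n%:R _ (ler0n _ _)).
    by rewrite -(flowD flowT) subrr (flow0 flowT).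
  rewrite measureD ?NE ?ltey_eq ?fin_num_measure//.
  by rewrite -[X in (X - _)%E](mpT (- n%:R) mN) subee// fin_num_measure.
(* Starting further in the past by an integer above [|t|] leaves a nonnegative time, over which
   forward invariance of [N] applies. *)
have invQ t : T t @^-1` Q = Q.
  apply/seteqP; split => x Qx n _ /=.
    have {}Qx := Qx (n + (Num.truncn `|t|).+1)%N I.
    rewrite /= -(flowD flowT) in Qx.
    set a := _ + _ in Qx.
    rewrite -[- n%:R](subrK a) (flowD flowT).
    apply: fwd => //.
    have /andP[_ /ltW tt] := truncn_itv (normr_ge0 t).
    rewrite /a natrD; have := ler_norm t; lra.
  have {}Qx := Qx (n + (Num.truncn `|t|).+1)%N I.
  rewrite /= in Qx; set a := - _%:R in Qx.
  rewrite -(flowD flowT) -[- n%:R + t](subrK a) (flowD flowT); apply: fwd => //.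
  have /andP[_ /ltW tt] := truncn_itv (normr_ge0 t).
  by rewrite /a natrD; have := ler_norm (- t); rewrite normrN; lra.
have Q0 : m Q = 0%E.
  have [//|Q1] := erg _ mQ invQ.
  suff : (m (hit 1) <= 0)%E.
    by move=> /(le_trans le_measure_hit1); rewrite leNgt C0.
  rewrite -[leRHS](subee (x := 1%E))// -[X in (_ <= _ - X)%E]Q1.
  rewrite -probability_setC//; apply: le_measure; rewrite ?inE//.
  - exact: measurable_hit.
  - exact: measurableC.
  - move=> x hx /(_ 0%N I) /=; rewrite oppr0 (flow0 flowT).
    by apply; exists 1%N.
have NE : (m N = m (N `\` Q) + m (N `&` Q))%E by exact: measureDI.
rewrite NE NQ add0e; apply: (subset_measure0 _ mQ _ Q0) => //.
exact: measurableI.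
Qed.

End hit.

(** * Coboundaries that are constant on long orbit segments *)

Section block_function.
Context {d : measure_display} {R : realType} {X : measurableType d}.
Context (m : probability X R) (T : R -> X -> X).
Context (mpT : measure_preserving_flow m T).
Notation mu := (@lebesgue_measure R).

Let flowT : measurable_flow T. Proof. by case: mpT. Qed.

Let preT t (A : set X) : measurable A -> m (T t @^-1` A) = m A.
Proof. by case: mpT => _; exact. Qed.

(* [tower_floor C n i] collects the points whose hitting time of [C] lies between
   [i * n] and [(i + 1) * n]; flowing forward for time [n] goes down by at most
   one floor. *)
Definition tower_floor (C : set X) (n i : nat) : set X :=
  hit T C (i.+1 * n)%:R `\` hit T C (i * n)%:R.

Section tower_floor.
Context (C : set X) (mC : measurable C) (n : nat).

Lemma measurable_tower_floor i : measurable (tower_floor C n i).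
Proof. by apply: measurableD; exact: measurable_hit. Qed.

Let hit_subn i j x : (i <= j)%N ->
  hit T C (i * n)%:R x -> hit T C (j * n)%:R x.
Proof. by move=> ij; apply: hit_sub => //; rewrite ler_nat leq_mul2r ij orbT. Qed.

Lemma tower_floor_inj i j x : tower_floor C n i x -> tower_floor C n j x -> i = j.
Proof.
move=> [hi nhi] [hj nhj]; case: (ltngtP i j) => // ij.
- by case: nhj; apply: hit_subn hi.
- by case: nhi; apply: hit_subn hj.
Qed.

(** A point of floor [i.+1] has no hit before time [n], so up to then flowing only shortens its
    hitting time. From floor 0 the orbit could pass [C] and reach any floor, hence the successor. *)
Lemma tower_floor_step i s x : 0 <= s <= n%:R -> tower_floor C n i.+1 x ->
  tower_floor C n i (T s x) \/ tower_floor C n i.+1 (T s x).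
Proof.
move=> /andP[s0 sn] [hx nhx].
have nhs : ~ hit T C s x.
  move=> hs; apply: nhx; apply: hit_sub hs => //.
  by rewrite (le_trans sn)// ler_nat leq_pmull.
have nhi : ~ hit T C (i * n)%:R (T s x).
  move=> /(hit_flow flowT mC s0) hs; apply: nhx; apply: hit_sub hs => //.
  by rewrite mulSn natrD addrC lerD2r.
have hs : hit T C (i.+2 * n)%:R (T s x).
  apply: hit_flow_inv => //.
  by apply: hit_sub hx => //; rewrite lerDl.
have [hi|hi] := pselect (hit T C (i.+1 * n)%:R (T s x)); first by left.
by right.
Qed.

Lemma tower_floor_flow i k x : tower_floor C n (i + k) x -> tower_floor C n i (T (k * n)%:R x).
Proof.
move=> [hx nhx].
have nhk : ~ hit T C (k * n)%:R x.
  by move=> hk; apply: nhx; apply: hit_subn hk; rewrite leq_addl.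
split.
  by apply: hit_flow_inv => //; rewrite -natrD -mulnDl addSn.
by move=> /(hit_flow flowT mC (ler0n _ _)); rewrite -natrD -mulnDl.
Qed.

Lemma tower_floor_cover : (0 < n)%N ->
  \bigcup_(i : nat) hit T C i%:R `<=` \bigcup_i tower_floor C n i.
Proof.
move=> n0 x [j _ hj].
have ex : exists i, `[< hit T C (i * n)%:R x >].
  exists j; apply/asboolP; apply: hit_sub hj => //.
  by rewrite ler_nat leq_pmulr.
case: (ex_minnP ex) => -[|i] /asboolP hi imin.
  by move: hi; rewrite mul0n => /(hit0 flowT mC).
exists i => //; split => // hi'.
by have := imin i; rewrite ltnn => H; have := H (asboolT hi').
Qed.

End tower_floor.

(** Going down one floor changes the parity of the block only at a multiple of [k]. *)
Lemma odd_divn_succ j k : (0 < k)%N -> ~~ (k %| j.+1)%N ->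
  odd (j %/ k) = odd (j.+1 %/ k).
Proof. by move=> k0 nk; rewrite divnS// (negbTE nk). Qed.

Lemma exists_bounded_injection : @standard_borel d R X ->
  exists e : X -> R, [/\ measurable_fun setT e, injective e &
    forall x, 0 <= e x <= 1].
Proof.
move=> [e [me e_inj _]]; exists (fun x => expR (- expR (e x))); split.
- apply: measurableT_comp => //; apply: measurableT_comp => //.
  exact: measurableT_comp.
- by move=> x y /expR_inj/oppr_inj/expR_inj/e_inj.
- by move=> x; rewrite expR_ge0/= -expR0 ler_expR oppr_le0 expR_ge0.
Qed.

(** Of the bound [2 / K.+1], one half covers the points that hit too early and the other the floors
    at block boundaries; the points that never hit are null. *)
Lemma exists_block_function (n K : nat) : @standard_borel d R X ->
  ergodic_flow m T -> aperiodic_flow m T -> (0 < n)%N ->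
  exists g : X -> R, exists B : R, exists E : set X,
   [/\ measurable_fun setT g /\ (forall x, `|g x| <= 1),
       (\int[m]_x (g x)%:E = 0)%E,
       forall t x, 0 <= t -> `|\int[mu]_(s in `[0, t]) g (T s x)| <= B &
       [/\ measurable E, (m (~` E) <= (2 / K.+1%:R)%:E)%E &
         forall x, E x -> `|\int[mu]_(s in `[0, n%:R]) g (T s x)| = n%:R]].
Proof.
move=> /exists_bounded_injection[e [me e_inj e01]] erg aper n0.
(* Blocks have [k] floors; the floors [0] to [k] have hit by time [H]. *)
pose k := K.+1; pose H := (k.+1 * n)%N.
have [C [mC C0 HC]] :=
  exists_local_section flowT me e_inj e01 (K * H.+1 + H)%N aper.
have small := hit_small flowT mC preT HC.
have full := ae_hit flowT mC preT erg C0.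
have mW := measurable_tower_floor mC n.
pose W := tower_floor C n.
(* [V b] gathers the lowest floors of the blocks with offset [b]. The [k] offsets give disjoint
   sets, so some [b] makes it small. *)
pose V b := \bigcup_(i in [set i | (k %| i + b)%N]) W i.
have mV b : measurable (V b) by exact: bigcup_measurable.
have dV i j x : (i < j <= K)%N -> V i x -> ~ V j x.
  move=> /andP[ij jK] [p /= kpi Wp] [q /= kqj Wq].
  rewrite -(tower_floor_inj mC Wp Wq) in kqj.
  have : (k %| j - i)%N by rewrite -(subnDl p) dvdn_sub.
  by rewrite gtnNdvd ?subn_gt0// ltnS (leq_trans (leq_subr _ _)).
have [b bK Vb] := disjoint_family_small m mV dV.
pose P := \bigcup_(i in [set i | odd ((i + b) %/ k)]) W i.
have mP : measurable P by exact: bigcup_measurable.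
have PW i x : W i x -> \1_P x = (odd ((i + b) %/ k))%:R :> R.
  move=> Wx; rewrite indicE; congr (_%:R); congr nat_of_bool.
  apply/idP/idP => [|oi]; last by rewrite inE; exists i.
  by rewrite inE => -[j /= oj Wj]; rewrite (tower_floor_inj mC Wx Wj).
pose a : R := (k * n)%:R.
pose g x : R := \1_P x - \1_P (T a x).
have mI : measurable_fun setT (\1_P : X -> R) by exact: measurable_indic.
have mIT : measurable_fun setT (fun x => \1_P (T a x) : R).
  exact: measurableT_comp mI (measurable_flow_time flowT a).
have I1 x : `|\1_P x : R| <= 1 by rewrite indicE; case: (_ \in _); rewrite ?normr0 ?normr1.
(* [k < i] lets the orbit drop one floor during time [n] and still have [k] floors below it; the
   other condition keeps it in its block. *)
pose E := \bigcup_(i in [set i | (k < i)%N && ~~ (k %| i + b)%N]) W i.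
exists g, (2 * 1 * a), E; split.
- split; first exact: measurable_funB.
  by move=> x; rewrite /g !indicE; case: (_ \in _); case: (_ \in _);
    rewrite ?subrr ?subr0 ?sub0r ?normrN ?normr0 ?normr1.
- rewrite /g; under eq_integral do rewrite EFinB.
  have mTP := measurable_flow_preimage flowT a mP.
  rewrite integralB_EFin//; last 2 first.
    exact: (probability_integrable_bounded m mI I1).
    exact: (probability_integrable_bounded m mIT (fun x => I1 (T a x))).
  have -> : (\int[m]_x (\1_P x)%:E = m P)%E by rewrite integral_indic// setIT.
  have -> : (\int[m]_x (\1_P (T a x))%:E = m P)%E.
    by rewrite -(preT a mP) -[X in _ = m X]setIT -integral_indic.
  by rewrite subee// fin_num_measure.
- move=> t x t0; rewrite /g RintegralB//.
  + rewrite distrC.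
    (* [T a] and [T s] commute, so the shifted indicator is integrated along the orbit of [T a x];
       this costs at most [2 * a], whatever [t] is. *)
    under [X in X - _]eq_Rintegral do rewrite -(flowD flowT) addrC (flowD flowT).
    exact: normr_orbit_integral_flowB.
  + apply: (@integrable_itv_bounded _ _ 1) => //.
    exact: (measurable_orbit_comp flowT x mI).
  + apply: (@integrable_itv_bounded _ _ 1) => //.
    exact: (measurable_orbit_comp flowT x mIT).
- split.
  + exact: bigcup_measurable.
  + set N := ~` \bigcup_(i : nat) hit T C i%:R in full *.
    have mN : measurable N.
      by apply: measurableC; apply: bigcup_measurable => i _; exact: measurable_hit.
    have mH : measurable (hit T C H%:R) by exact: measurable_hit.
    have mNH : measurable (N `|` hit T C H%:R) by exact: measurableU.
    have subE : (m (~` E) <= m ((N `|` hit T C H%:R) `|` V b))%E.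
      apply: le_measure; rewrite ?inE.
      * by apply: measurableC; exact: bigcup_measurable.
      * exact: measurableU.
      * move=> x Ex; have [/(tower_floor_cover mC n0)[i _ Wx]|] :=
          pselect ((\bigcup_(i : nat) hit T C i%:R) x); last by left; left.
        have [kib|kib] := boolP (k %| i + b)%N; first by right; exists i.
        left; right; have [ik|ki] := leqP i k; last first.
          by case: Ex; exists i => //=; rewrite ki.
        case: Wx => hx _; apply: hit_sub hx => //.
        by rewrite ler_nat leq_mul2r ltnS ik orbT.
    have U1 : (m (N `|` hit T C H%:R) <= m N + m (hit T C H%:R))%E.
      exact: measureU2.
    have U2 : (m ((N `|` hit T C H%:R) `|` V b) <=
        m (N `|` hit T C H%:R) + m (V b))%E by exact: measureU2.
    rewrite mulr_natl mulr2n EFinD (le_trans (le_trans subE U2))// leeD//.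
    by rewrite (le_trans U1)// full add0e.
  + move=> x [[//|i] /andP[ki nki] Wx].
    pose o := odd ((i.+1 + b) %/ k).
    (* All points of the segment lie in a block of parity [o], and [T a] moves them down by exactly
       [k] floors, into a block of the other parity. *)
    have gE s : s \in `[0, n%:R] -> g (T s x) = o%:R - (~~ o)%:R.
      rewrite in_itv/= => sn.
      have [j [kj oj Wj]] : exists j, [/\ (k <= j)%N, odd ((j + b) %/ k) = o &
          W j (T s x)].
        have [Wi|Wi] := tower_floor_step mC sn Wx; [exists i|exists i.+1]; split => //.
        - by rewrite /o addSn; apply: odd_divn_succ.
        - exact: ltnW.
      rewrite /g (PW _ _ Wj) oj.
      rewrite -(subnK kj) in Wj oj.
      rewrite (PW _ _ (tower_floor_flow mC Wj)) -oj addnAC divnDr// divnn addn1/=.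
      by rewrite negbK.
    have -> : \int[mu]_(s in `[0, n%:R]) g (T s x) =
        \int[mu]_(s in `[0, n%:R]) (o%:R - (~~ o)%:R).
      by apply: eq_Rintegral => s; rewrite inE; exact: gE.
    rewrite Rintegral_cst//= lebesgue_measure_itv/= lte_fin ltr0n n0/= subr0.
    by rewrite normrM (normr_nat _ n); case: (o);
      rewrite ?subr0 ?sub0r ?normrN normr1 mul1r.
Qed.

End block_function.

(** * Geometric weights and the tails of their series *)

(** With ratio [1 / 16], the tail bound [2 * weight k.+1] equals [weight k / 8]. *)
Definition weight {R : realType} (j : nat) : R := 16^-1 ^+ j.

Section geometric_series.
Context {R : realType}.
Notation c := (@weight R).

Lemma cvg_series_weight (u : nat -> R) :
  (forall j, `|u j| <= c j) -> cvgn (series u).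
Proof.
move=> uc; apply: normed_cvg.
apply: (series_le_cvg (v_ := geometric 1 16^-1)) => [j|j|j|].
- exact: normr_ge0.
- by rewrite /geometric/= mul1r exprn_ge0.
- by rewrite /geometric/= mul1r.
- by apply: is_cvg_geometric_series; rewrite ger0_norm// invf_lt1// ltr1n.
Qed.

Lemma normr_series_weight_tail (u : nat -> R) k :
  (forall j, `|u j| <= c j) ->
  `|limn (series u) - series u k| <= 2 * c k.
Proof.
move=> uc; have cu := cvg_series_weight uc.
have c0 j : 0 <= c j by rewrite exprn_ge0.
(* The subtracted term makes the induction close: each step gains [15 / 8 * c (i + k)], more than
   the [c (i + k)] that is added. *)
have H i : `|series u (i + k)%N - series u k| <= 2 * (c k - c (i + k)%N).
  elim: i => [|i IH]; first by rewrite !subrr normr0 mulr0.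
  have -> : series u (i.+1 + k)%N = series u (i + k)%N + u (i + k)%N.
    by rewrite addSn !seriesEnat/= big_nat_recr.
  have cS : c (i.+1 + k)%N = 16^-1 * c (i + k)%N by rewrite /weight addSn exprS.
  have uci : `|u (i + k)%N| <= c (i + k)%N := uc _.
  rewrite cS addrAC (le_trans (ler_normD _ _))//.
  move: IH uci (c0 (i + k)%N); move: (c (i + k)%N) (c k) => y z.
  by set v := `|series u _ - _|; set w := `|u _|; lra.
have : (fun n => `|series u n - series u k|) @ \oo -->
    `|limn (series u) - series u k|.
  by apply: cvg_norm; apply: cvgB => //; exact: cvg_cst.
move=> cv; rewrite -(cvg_lim _ cv)//; apply: limr_le.
  by apply/cvg_ex; eexists; exact: cv.
near=> n; have kn : (k <= n)%N by near: n; exists k.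
rewrite -(subnK kn) (le_trans (H _))// ler_wpM2l// lerBlDr lerDl.
exact: c0.
Unshelve. all: by end_near. Qed.

End geometric_series.

(** * The weighted sum of the block functions and its averages *)

Section gliding_hump.
Context {d : measure_display} {R : realType} {X : measurableType d}.
Context (m : probability X R) (T : R -> X -> X) (flowT : measurable_flow T).
Context (g : nat -> X -> R) (mg : forall k, measurable_fun setT (g k)).
Context (g1 : forall k x, `|g k x| <= 1).
Context (g0 : forall k, (\int[m]_x (g k x)%:E = 0)%E).
Notation mu := (@lebesgue_measure R).

Notation c := (@weight R).

Let u x j : R := c j * g j x.

Let c_ge0 j : 0 <= c j. Proof. by rewrite exprn_ge0. Qed.

Let u_le x j : `|u x j| <= c j.
Proof. by rewrite normrM ger0_norm// ler_piMr. Qed.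

Definition hump_partial (k : nat) (x : X) : R :=
  series (fun j => c j * g j x) k.

Definition hump (x : X) : R := limn (hump_partial ^~ x).

Lemma hump_partialS k x :
  hump_partial k.+1 x = hump_partial k x + c k * g k x.
Proof. by rewrite /hump_partial !seriesEnat/= big_nat_recr. Qed.

Lemma hump_partial0 x : hump_partial 0 x = 0.
Proof. by rewrite /hump_partial seriesEnat/= big_geq. Qed.

Lemma hump_tail k x : `|hump x - hump_partial k x| <= 2 * c k.
Proof. exact: (normr_series_weight_tail _ (u_le x)). Qed.

Lemma measurable_hump_partial k : measurable_fun setT (hump_partial k).
Proof.
elim: k => [|k IH].
  rewrite (_ : hump_partial 0 = cst 0)//.
  by apply/funext => x; exact: hump_partial0.
rewrite (_ : hump_partial k.+1 = fun x => hump_partial k x + c k * g k x).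
  2: by apply/funext => x; exact: hump_partialS.
by apply: measurable_funD => //; apply: measurable_funM.
Qed.

Lemma measurable_hump : measurable_fun setT hump.
Proof.
apply: (measurable_fun_cvg (h := hump_partial)) => //.
  exact: measurable_hump_partial.
by move=> x _; exact: (cvg_series_weight (u_le x)).
Qed.

Lemma hump_bounded x : `|hump x| <= 2.
Proof. by have := hump_tail 0 x; rewrite hump_partial0 subr0 /weight expr0 mulr1. Qed.

Lemma hump_partial_bounded k x : `|hump_partial k x| <= 4.
Proof.
have := hump_tail k x; have := hump_bounded x.
have : c k <= 1 by rewrite exprn_ile1// invf_le1// ler1n.
rewrite (distrC (hump x)) => h1 h2 h3.
by rewrite -[hump_partial k x](subrK (hump x)) (le_trans (ler_normD _ _))//; lra.
Qed.

(** The partial sums have mean zero and converge uniformly to [hump]. *)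
Lemma integral_hump : (\int[m]_x (hump x)%:E = 0)%E.
Proof.
have ih := probability_integrable_bounded m measurable_hump hump_bounded.
have ip k := probability_integrable_bounded m (measurable_hump_partial k)
  (hump_partial_bounded k).
have ig k := probability_integrable_bounded m (mg k) (g1 k).
have p0 k : \int[m]_x hump_partial k x = 0.
  elim: k => [|k IH].
    by under eq_Rintegral do rewrite hump_partial0; rewrite Rintegral_cst// mul0r.
  under eq_Rintegral do rewrite hump_partialS.
  rewrite RintegralD//; last first.
    apply: (probability_integrable_bounded _ (M := c k)).
      exact: measurable_funM.
    exact: (u_le^~ k).
  by rewrite IH RintegralZl// /Rintegral g0 mulr0 addr0.
suff R0 : \int[m]_x hump x = 0.
  by rewrite -[LHS]fineK ?(integrable_fin_num measurableT ih)//; congr EFin.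
apply/eqP; rewrite -normr_le0.
have H k : `|\int[m]_x hump x| <= 2 * c k.
  rewrite -[\int[m]_x hump x]subr0 -(p0 k) -RintegralB//.
  have ihp : m.-integrable setT (EFin \o (fun x => hump x - hump_partial k x)).
    apply: (probability_integrable_bounded _ _ (hump_tail k)).
    apply: measurable_funB; first exact: measurable_hump.
    exact: measurable_hump_partial.
  rewrite (le_trans (le_normr_Rintegral _ ihp))//.
  have -> : 2 * c k = \int[m]_x (2 * c k).
    transitivity (2 * c k * fine (m setT)); last by rewrite Rintegral_cst.
    by rewrite probability_setT mulr1.
  apply: le_Rintegral => //; first exact: integrable_norm.
    by apply: (probability_integrable_bounded _ (M := `|2 * c k|)).
  by move=> x _; exact: hump_tail.
have cv : (fun k => 2 * c k) @ \oo --> (2 * 0 : R).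
  apply: cvgM; first exact: cvg_cst.
  by apply: cvg_expr; rewrite ger0_norm// invf_lt1// ltr1n.
rewrite mulr0 in cv.
apply: (ler_cvg_to (cvg_cst _) cv); exact: nearW.
Qed.

Lemma hump_partial_orbit_integral (B : nat -> R) k t x : 0 <= t ->
  (forall j, `|\int[mu]_(s in `[0, t]) g j (T s x)| <= B j) ->
  `|\int[mu]_(s in `[0, t]) hump_partial k (T s x)| <= \sum_(j < k) c j * B j.
Proof.
move=> t0 gB; elim: k => [|k IH].
  under eq_Rintegral do rewrite hump_partial0.
  by rewrite Rintegral_cst// mul0r normr0 big_ord0.
have ip : mu.-integrable `[0, t] (EFin \o (fun s => hump_partial k (T s x))).
  apply: (@integrable_itv_bounded _ _ 4) => [|s]; last exact: hump_partial_bounded.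
  exact: (measurable_orbit_comp flowT x (measurable_hump_partial k)).
have ig : mu.-integrable `[0, t] (EFin \o (fun s => g k (T s x))).
  apply: (@integrable_itv_bounded _ _ 1) => //.
  exact: (measurable_orbit_comp flowT x (mg k)).
under eq_Rintegral do rewrite hump_partialS.
rewrite RintegralD ?RintegralZl//; last first.
  exact: (integrableZl _ _ ig).
rewrite big_ord_recr/= (le_trans (ler_normD _ _))// lerD// normrM.
by rewrite ger0_norm// ler_wpM2l.
Qed.

(** The term [k] contributes exactly [c k * t] in absolute value; the earlier terms and the later
    ones remove at most [c k / 8 * t] each, which leaves more than half. *)
Lemma hump_average_ge t k x : 0 < t ->
  `|\int[mu]_(s in `[0, t]) hump_partial k (T s x)| <= c k / 8 * t ->
  `|\int[mu]_(s in `[0, t]) g k (T s x)| = t ->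
  c k / 2 <= `|birkhoff_avg T hump t x|.
Proof.
move=> t0 pB gB.
have mh := measurable_orbit_comp flowT x measurable_hump.
have mp j := measurable_orbit_comp flowT x (measurable_hump_partial j).
have ih : mu.-integrable `[0, t] (EFin \o (fun s => hump (T s x))).
  by apply: (@integrable_itv_bounded _ _ 2) => // s; exact: hump_bounded.
have ip j : mu.-integrable `[0, t] (EFin \o (fun s => hump_partial j (T s x))).
  by apply: (@integrable_itv_bounded _ _ 4) => // s; exact: hump_partial_bounded.
have ig : mu.-integrable `[0, t] (EFin \o (fun s => g k (T s x))).
  apply: (@integrable_itv_bounded _ _ 1) => //.
  exact: (measurable_orbit_comp flowT x (mg k)).
have tail : `|\int[mu]_(s in `[0, t]) (hump (T s x) - hump_partial k.+1 (T s x))|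
    <= c k / 8 * t.
  have -> : c k / 8 * t = 2 * c k.+1 * (t - 0).
    by rewrite subr0 /weight exprS; field.
  apply: normr_Rintegral_itv_le => [|s|]; last exact: ltW.
    exact: measurable_funB.
  exact: hump_tail.
move: tail; rewrite RintegralB//.
have -> : \int[mu]_(s in `[0, t]) hump_partial k.+1 (T s x) =
    \int[mu]_(s in `[0, t]) hump_partial k (T s x) +
    c k * \int[mu]_(s in `[0, t]) g k (T s x).
  under eq_Rintegral do rewrite hump_partialS.
  rewrite RintegralD ?RintegralZl//; exact: (integrableZl _ _ ig).
rewrite /birkhoff_avg normrM (gtr0_norm (x := t^-1)) ?invr_gt0//.
rewrite ler_pdivlMl//.
move: pB gB (c_ge0 k).
set a := \int[mu]_(s in _) hump_partial _ _; set b := \int[mu]_(s in _) g _ _.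
set h := \int[mu]_(s in _) hump _ => pB gB ck tail.
have : `|c k * b| = c k * t by rewrite normrM gB ger0_norm.
have ct : 0 <= c k * t by rewrite mulr_ge0// ltW.
have := lerB_normD (c k * b) a.
have := lerB_normD (c k * b + a) (h - (a + c k * b)).
rewrite (addrC (c k * b) a) subrKC.
move: pB ct tail; move: (c k * b) => p; set y := c k; lra.
Qed.

End gliding_hump.

(** The bounds are not summable, but they tend to zero: the set of points missing every [E k] with
    [k >= k0] lies in each of these complements, hence is null. *)
Lemma ae_infinitely_often (d : measure_display) (R : realType)
    (X : measurableType d) (m : probability X R) (E : nat -> set X) :
  (forall k, measurable (E k)) ->
  (forall k, (m (~` E k) <= (2 / k.+1%:R)%:E)%E) ->
  {ae m, forall x, forall k0, exists2 k, (k0 <= k)%N & E k x}.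
Proof.
move=> mE mEk.
pose Z k0 := \bigcap_k ~` E (k + k0)%N.
have mZ k0 : measurable (Z k0).
  by apply: bigcap_measurableType => k _; exact: measurableC.
apply: (@negligibleS _ _ _ _ (\bigcup_k0 Z k0)).
  move=> x /= /existsNP[k0 H]; exists k0 => // k _ /= Ek; apply: H.
  by exists (k + k0)%N => //; rewrite leq_addl.
apply: negligible_bigcup => k0; apply/negligibleP => //.
apply/eqP; rewrite eq_le measure_ge0 andbT.
apply/lee_addgt0Pr => eps eps0; rewrite add0e.
pose k := Num.truncn (2 / eps).
apply: (@le_trans _ _ (m (~` E (k + k0)%N))).
  apply: le_measure; rewrite ?inE//; first exact: measurableC.
  by move=> x /(_ k I).
rewrite (le_trans (mEk _))// lee_fin ler_pdivrMr// -ler_pdivrMl// mulrC.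
have /andP[_ /ltW h] := truncn_itv (divr_ge0 (ler0n R 2) (ltW eps0)).
by rewrite (le_trans h)// ler_nat ltnS leq_addr.
Qed.

(** * Inductive choice of the times, and conclusion *)

Theorem theorem3 (R : realType) (d : measure_display) (X : measurableType d)
  (m : probability X R) (T : R -> X -> X) (phi : R -> R) :
  @standard_borel d R X ->
  measure_preserving_flow m T ->
  ergodic_flow m T ->
  aperiodic_flow m T ->
  (forall t, 0 < t -> 0 < phi t) ->
  phi t @[t --> +oo] --> 0 ->
  exists f : X -> R,
    [/\ m.-integrable setT (EFin \o f),
        (\int[m]_x (f x)%:E = 0)%E &
        {ae m, forall x, forall M : R, forall t0 : R, exists t : R,
           t0 < t /\ 0 < t /\ M < `|birkhoff_avg T f t x| / phi t}].
Proof.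
move=> sb mpT erg aper phi_gt0 phi_cvg; have [flowT _] := mpT.
have c_gt0 j : 0 < weight j :> R by rewrite exprn_gt0// invr_gt0.
(* A pair [p] stands for the segment length [p.1.+1], thus positive, and the precision [p.2]. *)
have [G HG] := choice (fun p : nat * nat =>
  exists_block_function mpT p.2 sb erg aper (ltn0Sn p.1)).
have [B {}HG] := choice HG.
have [E {}HG] := choice HG.
(* [q.1] is the rank [k] and [q.2] a bound for the orbit integrals of the terms before [k], which
   become negligible at time [n.+1]. *)
have step (q : nat * R) : exists n : nat, [/\ (q.1 <= n)%N,
    q.2 <= weight q.1 / 8 * n.+1%:R & phi n.+1%:R <= weight q.1 / q.1.+1%:R].
  have eps0 : 0 < weight q.1 / q.1.+1%:R :> R by rewrite divr_gt0.
  have [A [_ HA]] := cvgr0_norm_le _ phi_cvg _ eps0.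
  pose a := `|q.2| / (weight q.1 / 8).
  exists (q.1 + Num.truncn `|A| + Num.truncn a)%N; split.
  - by rewrite -addnA leq_addr.
  - rewrite (le_trans (ler_norm _))// mulrC -ler_pdivrMr ?divr_gt0//.
    have /andP[_ /ltW h] := truncn_itv (divr_ge0 (normr_ge0 q.2)
      (ltW (divr_gt0 (c_gt0 q.1) (ltr0n R 8)))).
    by rewrite (le_trans h)// ler_nat ltnS leq_addl.
  - apply: le_trans (ler_norm _) _; apply: HA.
    have /andP[_ h] := truncn_itv (normr_ge0 A).
    rewrite (le_lt_trans (ler_norm _))// (lt_le_trans h)// ler_nat ltnS.
    by rewrite -addnA addnCA leq_addr.
have [nu Hnu] := choice step.
(* [S k] involves only the bounds of terms before [k], so the time of rank [k] may be chosen from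
   it; these bounds hold at all times, in particular at that one. *)
pose S := fix S k : R :=
  if k is j.+1 then S j + weight j * B (nu (j, S j), j) else 0.
pose p k := (nu (k, S k), k).
have SE k : S k = \sum_(j < k) weight j * B (p j).
  by elim: k => [|k IH]; rewrite ?big_ord0// big_ord_recr/= -IH.
pose g k := G (p k).
have mg k : measurable_fun setT (g k) by have [[]] := HG (p k).
have g1 k x : `|g k x| <= 1 by have [[_ h] _ _ _] := HG (p k); exact: h.
have g0 k : (\int[m]_x (g k x)%:E = 0)%E by have [] := HG (p k).
exists (hump g); split.
- apply: (probability_integrable_bounded _ _ (hump_bounded g1)).
  exact: measurable_hump.
- exact: integral_hump.
have : {ae m, forall x, forall k0, exists2 k, (k0 <= k)%N & E (p k) x}.
  apply: ae_infinitely_often => k; first by have [_ _ _ []] := HG (p k).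
  by have [_ _ _ []] := HG (p k).
apply: filterS => x Ex M t0.
(* The first summand makes [t] exceed [t0], the second makes [k.+1] exceed [2 * |M|]. *)
have [k k0 Ek] := Ex (Num.truncn `|t0| + Num.truncn (2 * `|M|))%N.
have [kn Sk phik] := Hnu (k, S k); rewrite -/(p k) /= in kn Sk phik.
set t : R := (nu (k, S k)).+1%:R in Sk phik.
have t_gt0 : 0 < t by [].
exists t; split; last split => //.
  have /andP[_ h] := truncn_itv (normr_ge0 t0).
  rewrite (le_lt_trans (ler_norm _))// (lt_le_trans h)// ler_nat ltnS.
  by rewrite (leq_trans _ kn)// (leq_trans _ k0)// leq_addr.
have Ak : weight k / 2 <= `|birkhoff_avg T (hump g) t x|.
  apply: hump_average_ge => //.
  - apply: le_trans Sk; rewrite SE.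
    apply: (hump_partial_orbit_integral flowT mg g1 (B := B \o p)) => [|j].
      exact: ltW.
    by have [_ _ + _] := HG (p j); apply; exact: ltW.
  - by have [_ _ _ [_ _]] := HG (p k); apply.
rewrite ltr_pdivlMr ?phi_gt0// (lt_le_trans _ Ak)//.
(* The choice of [t] gives [phi t <= weight k / k.+1], and [|M| / k.+1 < 1 / 2] brings [M * phi t]
   below [weight k / 2]. *)
apply: le_lt_trans (_ : `|M| * (weight k / k.+1%:R) < _).
  rewrite (le_trans (ler_wpM2r (ltW (phi_gt0 _ t_gt0)) (ler_norm M)))//.
  by rewrite ler_wpM2l.
rewrite mulrCA ltr_pM2l// ltr_pdivrMr// mulrC ltr_pdivlMr// mulrC.
have /andP[_ h] := truncn_itv (mulr_ge0 (ler0n R 2) (normr_ge0 M)).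
by rewrite (lt_le_trans h)// ler_nat ltnS (leq_trans _ k0)// leq_addl.
Qed.
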